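(* Let $P_0,P_1$ be probability measures on a measurable space with $P_1\ll P_0$ and $\mathrm{KL}(P_1\|P_0)<\infty$, $R=\frac{dP_1}{dP_0}$, and let $\mathcal B$, $\beta_{\max}$, $\lambda$, $R_\beta$ be as in the context. For $\beta\in\mathcal B$ put $c_\beta:=\mathbb E_{P_1}[\log R_\beta]$. Then $$c_\beta=\beta\big(\mathrm{KL}(P_1\|P_0)+\lambda(\beta)\big),$$ and, assuming $\mathrm{KL}(P_0\|P_1)<\infty$ and $\log R$ not $P_0$-a.s. constant: (i) $\beta\mapsto c_\beta$ is strictly increasing on $(0,1)$ and strictly decreasing on $(1,\beta_{\max})$, with $\lim_{\beta\downarrow0}c_\beta=0$ and maximum $c_1=\mathrm{KL}(P_1\|P_0)$; (ii) $\beta\mapsto\lambda(\beta)$ is strictly decreasing on $\mathcal B$, with $\lim_{\beta\downarrow0}\lambda(\beta)=\mathrm{KL}(P_0\|P_1)$, $\lambda(1)=0$ and $\lambda(\beta)<0$ for $\beta>1$; (iii) $c_\beta/\beta$ increases to $\mathrm{KL}(P_0\|P_1)+\mathrm{KL}(P_1\|P_0)$ as $\beta\downarrow0$.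
   Context: $Z_\beta:=\mathbb E_{P_0}[R^\beta]$; $\mathcal B:=\{\beta>0:Z_\beta<\infty\}$, an interval containing $(0,1]$; $\beta_{\max}:=\sup\mathcal B\in[1,\infty]$. For $\beta\in\mathcal B$: $\lambda(\beta):=-\frac1\beta\log Z_\beta$ and $R_\beta:=R^\beta/Z_\beta$. Statements about $(1,\beta_{\max})$ or $\beta>1$ refer to $\beta\in\mathcal B$ and are vacuous if $\beta_{\max}=1$. *)

(* Defs.v *)
From HB Require Import structures.
From mathcomp Require Import all_boot all_order all_algebra.
From mathcomp Require Import all_classical all_reals all_analysis.
Set Implicit Arguments.
Unset Strict Implicit.
Unset Printing Implicit Defensive.
Import Order.TTheory GRing.Theory Num.Theory.
Import numFieldNormedType.Exports.
Local Open Scope classical_set_scope.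
Local Open Scope ring_scope.
Local Open Scope ereal_scope.

Section tilting.
Context {d : measure_display} {T : measurableType d} {R : realType}.

(* A version of the density dQ/dP: when Q `<< P it takes finite values
   everywhere, but is nonnegative only P-almost everywhere. *)
Definition density (Q P : probability T R) : T -> \bar R :=
  Radon_Nikodym (charge_of_finite_measure Q) P.

Definition KL (Q P : probability T R) : \bar R :=
  if `[< Q `<< P >] then \int[Q]_x lne (density Q P x) else +oo.

Variables P0 P1 : probability T R.

Definition Zpart (b : R) : \bar R := \int[P0]_x poweR (density P1 P0 x) b.

Definition Bset : set R := [set b | (0 < b)%R /\ Zpart b < +oo].

Definition beta_max : \bar R := ereal_sup (EFin @` Bset).

(* lambda, Rtilt and ctilt are total in b; they carry their meaning for
   b in Bset. *)
Definition lambda (b : R) : \bar R := - (b^-1%:E * lne (Zpart b)).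

Definition Rtilt (b : R) (x : T) : \bar R :=
  poweR (density P1 P0 x) b / Zpart b.

Definition ctilt (b : R) : \bar R := \int[P1]_x lne (Rtilt b x).

End tilting.

(* Main.v *)
(* Write L = log(dP1/dP0), K = E_P1[L] = KL(P1|P0), X = L - K. For b in B,
   Z_b = E_P1[exp((b-1)L)], so c_b = bK - log Z_b = K - log E_P1[exp((b-1)X)].
   For a centered nondegenerate X, t |-> E[exp(tX)] is strictly increasing on
   t >= 0 because exp(ty) - exp(sy) > (t-s)y when 0 <= s < t and y <> 0, and,
   by passing to -X, strictly decreasing on t <= 0; this yields (i).
   When P0 and P1 are equivalent, Z_b = E_P0[exp(bL)], so the monotonicity of
   lambda is the strict Lyapunov inequality for b |-> (log E_P0[exp(bL)])/b.
   Its limit at 0+ is E_P0[L] = -KL(P0|P1), by squeezing it between E_P0[L]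
   (Jensen) and E_P0[(exp(bL)-1)/b], which converges by domination. Finally
   c_b/b = K + lambda(b). *)
Require Import Defs.
From mathcomp Require Import all_boot all_order all_algebra.
From mathcomp Require Import all_classical all_reals all_analysis.
From mathcomp Require Import measurable_realfun ring lra.
Import Order.TTheory GRing.Theory Num.Theory.
Import numFieldNormedType.Exports.
Local Open Scope classical_set_scope.
Local Open Scope ring_scope.
Local Open Scope ereal_scope.

(** * Pointwise strict inequalities for the exponential *)

Section exponential_inequalities.
Local Set Implicit Arguments.
Local Unset Strict Implicit.
Local Open Scope ring_scope.
Context {R : realType}.
Implicit Types s t u x : R.

(** Factor out [expR (s * x)] and use the tangent bound on [expR ((t - s) * x)]: the surplus
    [(t - s) * (x * (expR (s * x) - 1))] is nonnegative, as its last two factors agree in sign. *)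
Lemma expR_chord_gt s t x : 0 <= s -> s < t -> x != 0 ->
  expR (s * x) + (t - s) * x < expR (t * x).
Proof.
move=> s0 st x0.
have d0 : (t - s) * x != 0 by rewrite mulf_neq0// subr_eq0 gt_eqF.
have H := expR_gt1Dx d0.
have -> : t * x = s * x + (t - s) * x by ring.
rewrite expRD.
have e0 := expR_gt0 (s * x).
have : 0 <= (t - s) * (x * (expR (s * x) - 1)).
  apply: mulr_ge0; first by rewrite subr_ge0 ltW.
  case: (lerP 0 x) => hx.
    by rewrite mulr_ge0// subr_ge0 -expR0 ler_expR mulr_ge0.
  rewrite mulr_le0 ?(ltW hx)// subr_le0 -expR0 ler_expR.
  by rewrite mulr_ge0_le0// ltW.
have : expR (s * x) * (1 + (t - s) * x) < expR (s * x) * expR ((t - s) * x).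
  by rewrite ltr_pM2l.
by lra.
Qed.

(** This is the strict Bernoulli inequality for [y ^ k] at [y = expR u]. It combines the tangent
    bounds at [(k - 1) * u] and at [- u], both multiplied by [expR u]. *)
Lemma expR_scale_gt (k : R) u : 1 < k -> u != 0 ->
  1 + k * (expR u - 1) < expR (k * u).
Proof.
move=> k1 u0.
have H1 : 1 + (k - 1) * u < expR ((k - 1) * u).
  by apply: expR_gt1Dx; rewrite mulf_neq0// subr_eq0 gt_eqF.
have H2 : 1 + - u < expR (- u) by apply: expR_gt1Dx; rewrite oppr_eq0.
have e0 := expR_gt0 u.
have E1 : expR (k * u) = expR u * expR ((k - 1) * u).
  by rewrite -expRD; congr expR; ring.
have E2 : expR u * expR (- u) = 1 by rewrite -expRD subrr expR0.
rewrite E1.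
have : expR u * (1 + (k - 1) * u) < expR u * expR ((k - 1) * u).
  by rewrite ltr_pM2l.
have : (k - 1) * (expR u * (1 + - u)) < (k - 1) * (expR u * expR (- u)).
  by rewrite ltr_pM2l ?subr_gt0// ltr_pM2l.
rewrite E2.
lra.
Qed.

Lemma expR_scale_ge (k : R) u : 1 <= k -> 1 + k * (expR u - 1) <= expR (k * u).
Proof.
rewrite le_eqVlt => /predU1P[<-|k1]; first by rewrite !mul1r addrC subrK.
have [->|u0] := eqVneq u 0; first by rewrite !mulr0 expR0 subrr mulr0 addr0.
exact/ltW/expR_scale_gt.
Qed.

End exponential_inequalities.

(** * Strict monotonicity of the real-valued integral *)

Section Rintegral_strict.
Local Set Implicit Arguments.
Local Unset Strict Implicit.
Local Open Scope ring_scope.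
Context d (T : measurableType d) (R : realType).
Variable mu : {measure set T -> \bar R}.
Implicit Types f g : T -> R.

(** With equal integrals, the nonnegative function [g - f] would have integral zero and so vanish
    almost everywhere. *)
Lemma lt_Rintegral f g :
  mu.-integrable setT (EFin \o f) -> mu.-integrable setT (EFin \o g) ->
  (forall x, f x <= g x) -> ~ {ae mu, forall x, f x = g x} ->
  \int[mu]_x f x < \int[mu]_x g x.
Proof.
move=> fi gi fg fNg.
rewrite lt_neqAle le_Rintegral// andbT.
apply/eqP => fgE; apply: fNg.
have gfi : mu.-integrable setT (EFin \o (g \- f)).
  by apply: (integrableB measurableT gi fi).
have : (\int[mu]_x (g x - f x)%:E = 0)%E.
  rewrite -[LHS]fineK; last exact: (integrable_fin_num measurableT gfi).
  by rewrite -/(Rintegral _ _ _) RintegralB// fgE subrr.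
move=> h.
have := ae_eq_integral_abs mu measurableT (measurable_int mu gfi).
move=> [+ _].
under eq_integral => x _ do rewrite /comp gee0_abs ?lee_fin ?subr_ge0//.
move=> /(_ h); apply: filterS => x /(_ I) /=.
by move=> [] /eqP; rewrite subr_eq0 => /eqP ->.
Qed.

End Rintegral_strict.

(** * Moment generating functions under a probability measure *)

Section exponential_moments.
Local Set Implicit Arguments.
Local Unset Strict Implicit.
Local Open Scope ring_scope.
Context d (T : measurableType d) (R : realType).
Variable P : probability T R.
Implicit Types X : T -> R.

Lemma integrable_cst_prob (k : R) : P.-integrable setT (EFin \o cst k).
Proof. exact: finite_measure_integrable_cst. Qed.

Lemma Rintegral_cst_prob (k : R) : \int[P]_x k = k.
Proof.
rewrite Rintegral_cst// -[RHS]mulr1; congr *%R.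
by transitivity (fine 1%E : R) => //; congr fine; exact: probability_setT.
Qed.

(** If [p] failed, the exceptional null set would be the whole space, of mass one. *)
Lemma probability_ae_cst (p : Prop) : {ae P, forall x, p} -> p.
Proof.
move=> h; apply: contrapT => np.
case: h => N [mN N0 sub].
have : P setT = 0%E.
  by apply: (subset_measure0 measurableT mN) N0 => x _; exact: sub.
have -> : P setT = 1%E by exact: probability_setT.
by move=> /eqP; rewrite onee_eq0.
Qed.

Lemma Rintegral_expR_gt0 X : P.-integrable setT (EFin \o (fun x => expR (X x))) ->
  0 < \int[P]_x expR (X x).
Proof.
move=> iX.
rewrite -[X in X < _]Rintegral_cst_prob; apply: lt_Rintegral => //.
- exact: integrable_cst_prob.
- move=> h; apply: probability_ae_cst; apply: filterS h => x /eqP.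
  by rewrite eq_sym expR_eq0.
Qed.

(** Adding [(t - s) * X], of mean zero, to the left integrand leaves its integral unchanged and
    makes [expR_chord_gt] a pointwise comparison, strict off [X = 0]. *)
Lemma mgf_centered_increasing X (s t : R) :
  P.-integrable setT (EFin \o X) -> \int[P]_x X x = 0 ->
  ~ {ae P, forall x, X x = 0} -> 0 <= s -> s < t ->
  P.-integrable setT (EFin \o (fun x => expR (s * X x))) ->
  P.-integrable setT (EFin \o (fun x => expR (t * X x))) ->
  \int[P]_x expR (s * X x) < \int[P]_x expR (t * X x).
Proof.
move=> iX X0 XN0 s0 st is_ it_.
have iZ : P.-integrable setT (EFin \o (fun x => (t - s) * X x)).
  exact: (integrableZl measurableT (t - s) iX).
have -> : \int[P]_x expR (s * X x) =
    \int[P]_x (expR (s * X x) + (t - s) * X x).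
  by rewrite RintegralD// RintegralZl// X0 mulr0 addr0.
apply: lt_Rintegral => //.
- exact: (integrableD measurableT is_ iZ).
- move=> x; have [->|x0] := eqVneq (X x) 0.
    by rewrite !mulr0 expR0 addr0.
  exact/ltW/expR_chord_gt.
- move=> h; apply: XN0; apply: filterS h => x hx.
  by apply/eqP; apply: contra_eqT hx => x0; rewrite lt_eqF// expR_chord_gt.
Qed.

(** Normalise by [c = ln Ma], so that [expR (a * X - c)] has mean one, and integrate the strict
    Bernoulli inequality with exponent [k = b / a] at [u = a * X - c]. This gives
    [1 < expR (- (k * c)) * Mb]. *)
Lemma lyapunov_strict X (a b : R) : 0 < a -> a < b ->
  ~ (exists c, {ae P, forall x, X x = c}) ->
  P.-integrable setT (EFin \o (fun x => expR (a * X x))) ->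
  P.-integrable setT (EFin \o (fun x => expR (b * X x))) ->
  ln (\int[P]_x expR (a * X x)) / a < ln (\int[P]_x expR (b * X x)) / b.
Proof.
move=> a0 ab XN ia ib.
have b0 : 0 < b by exact: lt_trans ab.
have Ma0 := Rintegral_expR_gt0 ia.
have Mb0 := Rintegral_expR_gt0 ib.
set Ma := \int[P]_x expR (a * X x) in Ma0 *.
set Mb := \int[P]_x expR (b * X x) in Mb0 *.
pose c := ln Ma; pose k := b / a.
have k1 : 1 < k by rewrite /k ltr_pdivlMr// mul1r.
have iaZ : P.-integrable setT (EFin \o (fun x => k * expR (- c) * expR (a * X x))).
  exact: (integrableZl measurableT (k * expR (- c)) ia).
have ibZ : P.-integrable setT (EFin \o (fun x => expR (- (k * c)) * expR (b * X x))).
  exact: (integrableZl measurableT (expR (- (k * c))) ib).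
have ek x : k * (a * X x - c) = - (k * c) + b * X x.
  by rewrite /k; field; rewrite gt_eqF.
have ptw x : a * X x - c != 0 -> 1 - k + k * expR (- c) * expR (a * X x) <
    expR (- (k * c)) * expR (b * X x).
  move=> /(expR_scale_gt k1); rewrite ek !expRD.
  lra.
have : \int[P]_x (1 - k + k * expR (- c) * expR (a * X x)) <
    \int[P]_x (expR (- (k * c)) * expR (b * X x)).
  apply: lt_Rintegral => //.
  - exact: (integrableD measurableT (integrable_cst_prob (1 - k)) iaZ).
  - move=> x; have [h|/ptw/ltW//] := eqVneq (a * X x - c) 0.
    rewrite -expRD -ek h mulr0 expR0 -mulrA -expRD [- c + _]addrC h expR0.
    by rewrite mulr1 subrK.
  (* Equality in Bernoulli forces [u = 0], hence [X] constant. *)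
  - move=> h; apply: XN; exists (c / a); apply: filterS h => x hx.
    have : a * X x - c = 0.
      by apply/eqP; apply: contra_eqT hx => x0; rewrite lt_eqF// ptw.
    by move/eqP; rewrite subr_eq0 => /eqP <-; field; rewrite gt_eqF.
rewrite RintegralD//; last exact: integrable_cst_prob.
rewrite Rintegral_cst_prob RintegralZl// RintegralZl// -/Ma -/Mb.
rewrite -mulrA [expR (- c)]expRN lnK ?posrE// mulVf ?gt_eqF// mulr1 subrK.
rewrite -[Mb in X in X -> _]lnK ?posrE// -expRD -expR0 ltr_expR.
rewrite ltr_pdivlMr// /k -/c; lra.
Qed.

(** The tangent line to the exponential at [b * m] lies below it, and its integral is
    [expR (b * m)]. *)
Lemma jensen_expR X (b : R) : P.-integrable setT (EFin \o X) ->
  P.-integrable setT (EFin \o (fun x => expR (b * X x))) ->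
  b * \int[P]_x X x <= ln (\int[P]_x expR (b * X x)).
Proof.
move=> iX ib; set m := \int[P]_x X x.
have Mb0 := Rintegral_expR_gt0 ib.
rewrite -ler_expR lnK ?posrE//.
have iZ : P.-integrable setT (EFin \o (fun x => expR (b * m) * b * X x)).
  exact: (integrableZl measurableT (expR (b * m) * b) iX).
have -> : expR (b * m) =
    \int[P]_x (expR (b * m) * (1 - b * m) + expR (b * m) * b * X x).
  rewrite RintegralD//; last exact: integrable_cst_prob.
  rewrite Rintegral_cst_prob RintegralZl// -/m; ring.
apply: le_Rintegral => //.
  exact: (integrableD measurableT (integrable_cst_prob _) iZ).
move=> x _.
have -> : b * X x = b * m + (b * X x - b * m) by ring.
rewrite [leRHS]expRD.
have := expR_ge1Dx (b * X x - b * m).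
rewrite -(ler_pM2l (expR_gt0 (b * m))); lra.
Qed.

(** The dominating function is [1 + expR (b * X)]: the second term serves where [X] is nonnegative,
    the first where it is negative. *)
Lemma integrable_expR_le X (a b : R) : measurable_fun setT X -> 0 <= a <= b ->
  P.-integrable setT (EFin \o (fun x => expR (b * X x))) ->
  P.-integrable setT (EFin \o (fun x => expR (a * X x))).
Proof.
move=> mX /andP[a0 ab] ib.
have := integrableD measurableT (integrable_cst_prob 1) ib.
apply: le_integrable => //.
  apply/measurable_EFinP; apply: measurableT_comp; first exact: measurable_expR.
  exact: measurable_funM.
move=> x _ /=; rewrite lee_fin !ger0_norm ?addr_ge0 ?expR_ge0//.
have [x0|x0] := leP 0 (X x).
  by apply: ler_wpDl => //; rewrite ler_expR ler_wpM2r.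
apply: ler_wpDr; first exact: expR_ge0.
by rewrite -expR0 ler_expR mulr_ge0_le0// ltW.
Qed.

Lemma ln_mgf_over_cvg X : P.-integrable setT (EFin \o X) ->
  P.-integrable setT (EFin \o (fun x => expR (X x))) ->
  ln (\int[P]_x expR (b * X x)) / b @[b --> 0^'+] --> \int[P]_x X x.
Proof.
move=> iX i1.
have mX : measurable_fun setT X by apply/measurable_EFinP; exact: measurable_int iX.
have ib (b : R) : 0 < b <= 1 -> P.-integrable setT (EFin \o (fun x => expR (b * X x))).
  move=> /andP[b0 b1]; apply: (integrable_expR_le (b := 1)) => //.
    by rewrite (ltW b0) b1.
  by move: i1; congr (_.-integrable _ _); apply/funext => x /=; rewrite mul1r.
pose q (b : R) x := (expR (b * X x) - 1) / b.
have qge (b : R) x : 0 < b -> X x <= q b x.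
  move=> b0; rewrite /q ler_pdivlMr//.
  have := expR_ge1Dx (b * X x); lra.
(* By convexity the difference quotient at [b] is at most the one at [1]; this is Bernoulli with
   exponent [b^-1] at [b * X x]. *)
have qle (b : R) x : 0 < b <= 1 -> q b x <= expR (X x) - 1.
  move=> /andP[b0 b1]; rewrite /q ler_pdivrMr//.
  have b1' : 1 <= b^-1 by rewrite invf_ge1.
  have := expR_scale_ge (b * X x) b1'.
  rewrite mulKf ?gt_eqF// -lerBrDl ler_pdivrMl// => /le_trans; apply.
  by rewrite mulrC.
have iq (b : R) : 0 < b <= 1 -> P.-integrable setT (EFin \o q b).
  move=> b01.
  have := integrableZl measurableT b^-1
    (integrableB measurableT (ib _ b01) (integrable_cst_prob 1)).
  by congr (_.-integrable _ _); apply/funext => x /=; rewrite /q -EFinM mulrC.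
(* Capping at [1] makes the bounds on [q] available for every positive [b], hence at every index of
   a sequence tending to [0]. *)
pose G (b : R) := \int[P]_x q (Num.min b 1) x.
have min01 (b : R) : 0 < b -> 0 < Num.min b 1 <= 1.
  by move=> b0; rewrite lt_min b0 ltr01 ge_min lexx orbT.
have GX : G b @[b --> 0^'+] --> \int[P]_x X x.
  (* Dominated convergence concerns sequences, so the limit is taken along an arbitrary one. *)
  apply/cvg_at_rightP => u [u0 ucvg].
  pose v n := Num.min (u n) 1.
  have v01 n : 0 < v n <= 1 by exact: min01.
  have vcvg : v n @[n --> \oo] --> 0.
    apply: (@squeeze_cvgr _ _ _ _ (fun=> 0) u) => //; last exact: cvg_cst.
    apply: nearW => n; have /andP[/ltW -> _] /= := v01 n.
    by rewrite /v ge_min lexx.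
  have dX : P.-integrable setT (EFin \o (fun x => `|X x| + expR (X x))).
    exact: (integrableD measurableT (integrable_norm iX) i1).
  have qX x : q (v n) x @[n --> \oo] --> X x.
    (* The upper bound is the tangent inequality at [- (v n * X x)] multiplied by
       [expR (v n * X x)]. *)
    apply: (@squeeze_cvgr _ _ _ _ (fun=> X x) (fun n => X x * expR (v n * X x))).
    - apply: nearW => n; have /andP[v0 _] := v01 n.
      rewrite qge//= /q ler_pdivrMr//.
      have := expR_ge1Dx (- (v n * X x)).
      rewrite -(ler_pM2l (expR_gt0 (v n * X x))) -expRD subrr expR0; lra.
    - exact: cvg_cst.
    - have h : v n * X x @[n --> \oo] --> 0.
        by rewrite -[0](mul0r (X x)); apply: (cvgM vcvg); exact: cvg_cst.
      have h1 : expR (v n * X x) @[n --> \oo] --> (1 : R).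
        rewrite -expR0; exact: cvg_comp h (@continuous_expR R 0).
      suff : X x * expR (v n * X x) @[n --> \oo] --> X x * 1 by rewrite mulr1.
      by apply: (cvgM _ h1); exact: cvg_cst.
  have [] := @dominated_convergence _ _ _ P setT measurableT
    (fun n x => (q (v n) x)%:E) (EFin \o X) (EFin \o (fun x => `|X x| + expR (X x))).
  - by move=> n; exact: measurable_int (iq _ (v01 n)).
  - exact: measurable_int iX.
  - apply: aeW => x _; apply: cvg_EFin; last exact: qX.
    exact: nearW.
  - exact: dX.
  - apply: aeW => x n _; rewrite /= lee_fin ler_norml.
    have /andP[v0 _] := v01 n.
    have := qge _ x v0; have := qle _ x (v01 n).
    have := expR_gt0 (X x); have := ler_norm (X x); have := ler_norm (- X x).
    rewrite normrN => *; apply/andP; split; lra.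
  move=> _ _.
  have XE : (\int[P]_x (EFin \o X) x = (\int[P]_x X x)%:E)%E.
    by rewrite /Rintegral fineK// (integrable_fin_num measurableT iX).
  by rewrite XE => /fine_cvg.
have H : \forall b \near (0 : R)^'+, 0 < b <= 1.
  near=> b; apply/andP; split => //.
  near: b; exact: nbhs_right_le.
(* Jensen gives the lower bound. For the upper one, the moment is [1 + b * G b] when [b <= 1], and
   [ln (1 + y) <= y]. *)
have Gn : \forall b \near (0 : R)^'+, \int[P]_x X x <= ln (\int[P]_x expR (b * X x)) / b <= G b.
  apply: filterS H => b b01.
  have /andP[b0 b1] := b01.
  apply/andP; split.
    by rewrite ler_pdivlMr// mulrC jensen_expR// ib.
  rewrite /G (min_idPl b1) ler_pdivrMr//.
  have ME : \int[P]_x expR (b * X x) = 1 + b * \int[P]_x q b x.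
    rewrite -(Rintegral_cst_prob 1) -RintegralZl//; last exact: iq.
    rewrite -RintegralD//.
    - by apply: eq_Rintegral => x _; rewrite /q; field; rewrite gt_eqF.
    - exact: integrable_cst_prob.
    - exact: (integrableZl measurableT b (iq _ b01)).
  rewrite ME mulrC; apply: le_ln1Dx.
  by have := Rintegral_expR_gt0 (ib _ b01); rewrite ME; lra.
apply: (squeeze_cvgr Gn _ GX).
exact: cvg_cst.
Unshelve. all: end_near.
Qed.

End exponential_moments.

(** * Measurability of the extended logarithm *)

Section extended_log.
Local Set Implicit Arguments.
Local Unset Strict Implicit.

Lemma measurable_lne (R : realType) : measurable_fun setT (@lne R).
Proof.
have -> : @lne R = fun x => if x <= 0 then -oo else
    if x == +oo then +oo else (ln (fine x))%:E.
  by apply/funext => -[x| |] /=; rewrite ?lee_fin ?leNye.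
apply: measurable_fun_ifT => //=; first exact: measurable_fun_lee.
apply: measurable_fun_ifT => //=; first exact: measurable_fun_eqe.
by apply/measurable_EFinP; apply: (@measurableT_comp _ _ _ _ _ _ (@ln R)).
Qed.

End extended_log.

(** * Integrability from a lower bound *)

Section integrability.
Local Set Implicit Arguments.
Local Unset Strict Implicit.
Context d (T : measurableType d) (R : realType).
Variable mu : {measure set T -> \bar R}.

(** The negative part of [f] is dominated by that of [h]; its integral being finite, the bound on
    the integral of [f] controls the positive part. This turns a finite divergence into
    integrability of the log-density. *)
Lemma integrable_lower_bound (f h : T -> R) : measurable_fun setT f ->
  mu.-integrable setT (EFin \o h) -> (forall x, (h x <= f x)%R) ->
  \int[mu]_x (f x)%:E < +oo -> mu.-integrable setT (EFin \o f).
Proof.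
move=> mf ih hf fy.
have mF : measurable_fun setT (EFin \o f) by exact/measurable_EFinP.
have iN : mu.-integrable setT (EFin \o f)^\-.
  apply: le_integrable (integrable_funeneg measurableT ih) => //.
    exact: measurable_funeneg.
  move=> x _; rewrite !gee0_abs ?funeneg_ge0//.
  rewrite !funenegE /= -!EFin_max lee_fin.
  by rewrite ge_max !le_max lerN2 hf /= lexx orbT.
have iP : mu.-integrable setT (EFin \o f)^\+.
  apply/integrableP; split; first exact: measurable_funepos.
  under eq_integral => x _ do rewrite gee0_abs ?funepos_ge0//.
  move: fy; rewrite integralE.
  have /fineK <- := integrable_fin_num measurableT iN.
  by case: (\int[mu]_x _) => [s||] /=; rewrite ?ltry ?ltxx.
by rewrite [EFin \o f]funeposneg; exact: integrableB.
Qed.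

End integrability.

(** * A real-valued density of [P1] and change of measure *)

Section change_of_measure.
Local Set Implicit Arguments.
Local Unset Strict Implicit.
Context d (T : measurableType d) (R : realType).

Lemma null_dominates_ae (mu nu : {measure set T -> \bar R}) (p : T -> Prop) :
  nu `<< mu -> {ae mu, forall x, p x} -> {ae nu, forall x, p x}.
Proof.
move=> /null_content_dominatesP numu [N [mN N0 sub]].
by exists N; split => //; exact: numu.
Qed.

Variables P0 P1 : probability T R.
Hypothesis P1_ac : P1 `<< P0.

(* [density P1 P0] is nonnegative only P0-a.e.; this version is so everywhere. *)
Definition dens (x : T) : R := fine (Radon_Nikodym_SigmaFinite.f P1 P0 x).

Lemma densE x : Radon_Nikodym_SigmaFinite.f P1 P0 x = (dens x)%:E.
Proof. by rewrite fineK//; exact: Radon_Nikodym_SigmaFinite.f_fin_num. Qed.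

Lemma dens_ge0 x : (0 <= dens x)%R.
Proof. by rewrite -lee_fin -densE Radon_Nikodym_SigmaFinite.f_ge0. Qed.

Lemma measurable_dens : measurable_fun setT dens.
Proof.
apply/measurable_EFinP; rewrite (_ : EFin \o dens = Radon_Nikodym_SigmaFinite.f P1 P0).
  exact: measurable_int (Radon_Nikodym_SigmaFinite.f_integrable P1_ac).
by apply/funext => x /=; rewrite densE.
Qed.

Lemma integrable_dens : P0.-integrable setT (EFin \o dens).
Proof.
rewrite (_ : EFin \o dens = Radon_Nikodym_SigmaFinite.f P1 P0).
  exact: Radon_Nikodym_SigmaFinite.f_integrable.
by apply/funext => x /=; rewrite densE.
Qed.

Lemma measurable_density : measurable_fun setT (density P1 P0).
Proof.
have := @Radon_Nikodym_integrable _ _ _ (charge_of_finite_measure P1) P0 P1_ac.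
exact: measurable_int.
Qed.

Lemma density_ae : {ae P0, forall x, density P1 P0 x = (dens x)%:E}.
Proof.
have := ae_eq_Radon_Nikodym_SigmaFinite P1_ac measurableT.
by apply: filterS => x /(_ I) h; rewrite /density -h densE.
Qed.

Lemma integral_dens (f : T -> R) : measurable_fun setT f ->
  (forall x, 0 <= f x)%R ->
  \int[P1]_x (f x)%:E = \int[P0]_x (f x * dens x)%:E.
Proof.
move=> mf f0.
rewrite -(Radon_Nikodym_SigmaFinite.change_of_variables P1_ac)//.
- by apply: eq_integral => x _; rewrite densE EFinM.
- exact/measurable_EFinP.
Qed.

(** The [P1]-mass of the zero set of [dens] is the [P0]-integral of [dens] over that set. *)
Lemma dens_gt0_ae : {ae P1, forall x, (0 < dens x)%R}.
Proof.
pose N := dens @^-1` [set 0%R].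
have mN : measurable N.
  by rewrite /N -[X in measurable X]setTI; apply: measurable_dens => //.
exists N; split => //.
- rewrite (Radon_Nikodym_SigmaFinite.f_integral P1_ac)//.
  by apply: integral0_eq => x Nx; rewrite densE Nx.
- by move=> x /= /negP; rewrite lt_neqAle dens_ge0 andbT negbK eq_sym => /eqP.
Qed.

(** As [ln] is [0] at [0], [L] is real everywhere; it is the true log-density only where [dens] is
    positive, hence [P1]-almost everywhere. *)
Let L x := ln (dens x).

Lemma measurable_ln_dens : measurable_fun setT L.
Proof. by apply: measurableT_comp; [exact: measurable_ln|exact: measurable_dens]. Qed.

Lemma lne_density_ae : {ae P1, forall x, lne (density P1 P0 x) = (L x)%:E}.
Proof.
have h := null_dominates_ae P1_ac density_ae.
by apply: filterS2 h dens_gt0_ae => x -> r0; rewrite lne_EFin.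
Qed.

Lemma KL_dens : KL P1 P0 = \int[P1]_x (L x)%:E.
Proof.
rewrite /KL; case: asboolP => // _.
apply: ae_eq_integral => //.
- apply: (measurableT_comp (@measurable_lne R)); exact: measurable_density.
- exact/measurable_EFinP/measurable_ln_dens.
- by apply: filterS lne_density_ae => x.
Qed.

(** Under [P0] the integrand becomes the indicator of [dens > 0], at most one. The function serves
    to bound [L] from below. *)
Lemma integrable_dens_inv : P1.-integrable setT (EFin \o (fun x => (dens x)^-1%R)).
Proof.
have mV : measurable_fun setT (fun x => (dens x)^-1%R).
  rewrite (_ : (fun x => (dens x)^-1%R) = (fun x => dens x `^ (-1))%R).
    by apply: (measurableT_comp (measurable_powR _)); exact: measurable_dens.
  by apply/funext => x; rewrite powR_inv1// dens_ge0.
have V0 x : (0 <= (dens x)^-1)%R by rewrite invr_ge0 dens_ge0.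
apply/integrableP; split; first exact/measurable_EFinP.
under eq_integral => x _ do rewrite gee0_abs ?lee_fin ?V0//.
rewrite integral_dens//.
have := integrable_fin_num measurableT (integrable_cst_prob P0 1).
rewrite fin_numElt => /andP[_]; apply: le_lt_trans.
apply: ge0_le_integral => //.
- by move=> x _; rewrite lee_fin mulr_ge0// dens_ge0.
- by apply/measurable_EFinP/measurable_funM => //; exact: measurable_dens.
- exact: measurable_int (integrable_cst_prob P0 1).
- move=> x _; rewrite lee_fin /=.
  (* Where [dens] vanishes, the product is [0]. *)
  by have [->|r0] := eqVneq (dens x) 0%R; rewrite ?mulr0// mulVf.
Qed.

(** The bound [ln y < y] at [y = (dens x)^-1] gives [L x >= - (dens x)^-1]; at [dens x = 0] both
    sides take the default value [0]. *)
Lemma integrable_ln_dens : KL P1 P0 < +oo -> P1.-integrable setT (EFin \o L).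
Proof.
rewrite KL_dens; apply: (@integrable_lower_bound _ _ _ _ _ (fun x => - (dens x)^-1)%R).
- exact: measurable_ln_dens.
- exact: (integrableN integrable_dens_inv).
- move=> x; rewrite /L; have [->|r0] := eqVneq (dens x) 0%R.
    by rewrite ln0// invr0 oppr0.
  have rp : (0 < dens x)%R by rewrite lt_neqAle eq_sym r0 dens_ge0.
  rewrite lerNl -lnV ?posrE//; apply/ltW/ln_sublinear.
  by rewrite invr_gt0.
Qed.

Lemma Zpart_dens b : Zpart P0 P1 b = \int[P0]_x (dens x `^ b)%:E.
Proof.
apply: ae_eq_integral => //.
- apply: (measurableT_comp (measurable_poweR b)); exact: measurable_density.
- apply/measurable_EFinP; apply: (measurableT_comp (measurable_powR b)).
  exact: measurable_dens.
- by apply: filterS density_ae => x ->.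
Qed.

(** One factor [dens] of the [b]-th power is absorbed by the change of measure, which leaves the
    exponent [b - 1]. *)
Lemma Zpart_expR1 b : (0 < b)%R ->
  Zpart P0 P1 b = \int[P1]_x (expR ((b - 1) * L x))%:E.
Proof.
move=> b0; rewrite Zpart_dens integral_dens//.
- apply: eq_integral => x _; congr EFin; rewrite /powR.
  (* At density [0] both sides vanish, the power because [b] is nonzero. *)
  case: eqVneq => [->|r0]; first by rewrite mulr0 gt_eqF.
  have rp : (0 < dens x)%R by rewrite lt_neqAle eq_sym r0 dens_ge0.
  by rewrite mulrBl mul1r expRD expRN lnK ?posrE// divfK.
- by apply: measurableT_comp => //; apply: measurable_funM => //; exact: measurable_ln_dens.
Qed.


Lemma Bset_dens b :
  Bset P0 P1 b <->
  (0 < b)%R /\ P0.-integrable setT (EFin \o (fun x => dens x `^ b)%R).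
Proof.
have m : measurable_fun setT (EFin \o (fun x => dens x `^ b)%R).
  by apply/measurable_EFinP; apply: (measurableT_comp (measurable_powR b)); exact: measurable_dens.
rewrite /Bset /= Zpart_dens; split => -[b0 h]; split => //.
- apply/integrableP; split => //.
  by under eq_integral => x _ do rewrite gee0_abs ?lee_fin ?powR_ge0//.
- by have := integrable_fin_num measurableT h; rewrite fin_numElt => /andP[].
Qed.

Lemma Bset1 : Bset P0 P1 1%R.
Proof.
apply/Bset_dens; split => //.
have := integrable_dens; congr (_.-integrable _ _).
by apply/funext => x /=; rewrite powRr1// dens_ge0.
Qed.

(** For [r >= 0] one has [r ^ a <= 1 + r ^ b], by comparing [r] with [1]. *)
Lemma Bset_le (a b : R) : (0 < a)%R -> (a <= b)%R -> Bset P0 P1 b -> Bset P0 P1 a.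
Proof.
move=> a0 ab /Bset_dens[b0 ib]; apply/Bset_dens; split => //.
have := integrableD measurableT (integrable_cst_prob P0 1) ib.
apply: le_integrable => //.
  by apply/measurable_EFinP; apply: (measurableT_comp (measurable_powR a)); exact: measurable_dens.
move=> x _ /=; rewrite lee_fin !ger0_norm ?addr_ge0 ?powR_ge0//.
have [r1|r1] := leP 1%R (dens x).
  by apply: ler_wpDl => //; exact: ler_powR.
apply: ler_wpDr; first exact: powR_ge0.
have -> : 1%R = (1 `^ a)%R :> R by rewrite powR1.
by apply: ge0_ler_powR; rewrite ?nnegrE ?dens_ge0// ltW.
Qed.

Lemma integrable_expR1 b : Bset P0 P1 b ->
  P1.-integrable setT (EFin \o (fun x => expR ((b - 1) * L x))%R).
Proof.
move=> [b0 Zy]; apply/integrableP; split.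
  apply/measurable_EFinP; apply: measurableT_comp => //.
  by apply: measurable_funM => //; exact: measurable_ln_dens.
by under eq_integral => x _ do rewrite gee0_abs ?lee_fin ?expR_ge0//;
  rewrite -Zpart_expR1.
Qed.

Lemma ZpartE b : Bset P0 P1 b ->
  Zpart P0 P1 b = (\int[P1]_x expR ((b - 1) * L x))%R%:E.
Proof.
move=> Bb; have [b0 _] := Bb.
rewrite Zpart_expR1// /Rintegral fineK//.
exact: (integrable_fin_num measurableT (integrable_expR1 Bb)).
Qed.

(** [P1]-almost everywhere the density is positive, so the logarithm of the tilted density splits
    into [b * L - ln z]. *)
Lemma ctiltE b : KL P1 P0 < +oo -> Bset P0 P1 b ->
  ctilt P0 P1 b = (b * \int[P1]_x L x -
    ln (\int[P1]_x expR ((b - 1) * L x)))%R%:E.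
Proof.
move=> Ky Bb; have [b0 _] := Bb.
have iL := integrable_ln_dens Ky.
have z0 := Rintegral_expR_gt0 (integrable_expR1 Bb).
set z := (\int[P1]_x expR ((b - 1) * L x))%R in z0 *.
have ibL : P1.-integrable setT (EFin \o (fun x => b * L x)%R).
  exact: (integrableZl measurableT b iL).
rewrite /ctilt.
transitivity (\int[P1]_x (b * L x - ln z)%:E).
  apply: ae_eq_integral => //.
  - apply: (measurableT_comp (@measurable_lne R)).
    apply: emeasurable_funM => //.
    by apply: (measurableT_comp (measurable_poweR b)); exact: measurable_density.
  - apply/measurable_EFinP/measurable_funB => //.
    by apply: measurable_funM => //; exact: measurable_ln_dens.
  - have h := null_dominates_ae P1_ac density_ae.
    apply: filterS2 h dens_gt0_ae => x Dx r0 _.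
    rewrite /Rtilt Dx ZpartE// -/z poweR_EFin inver gt_eqF// -EFinM.
    rewrite lne_EFin ?divr_gt0 ?powR_gt0//.
    by rewrite ln_div ?posrE ?powR_gt0// ln_powR.
have -> : \int[P1]_x (b * L x - ln z)%:E = (\int[P1]_x (b * L x - ln z)%R)%R%:E.
  rewrite /Rintegral fineK//.
  have := integrableB measurableT ibL (integrable_cst_prob P1 (ln z)).
  exact: (integrable_fin_num measurableT).
rewrite RintegralB//; last exact: integrable_cst_prob.
by rewrite Rintegral_cst_prob RintegralZl.
Qed.

Lemma lambdaE b : Bset P0 P1 b ->
  lambda P0 P1 b = (- (ln (\int[P1]_x expR ((b - 1) * L x)) / b))%R%:E.
Proof.
move=> Bb; have z0 := Rintegral_expR_gt0 (integrable_expR1 Bb).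
by rewrite /lambda ZpartE// lne_EFin// -EFinM -EFinN mulrC.
Qed.

(** * Finite reverse divergence: the two measures are equivalent *)

Section reverse.
Hypothesis KL01_fin : KL P0 P1 < +oo.

(** [KL] is [+oo] by definition when domination fails. *)
Lemma P0_ac : P0 `<< P1.
Proof. by move: KL01_fin; rewrite /KL; case: asboolP. Qed.

(** By the chain rule, the product of the two densities integrates to [P0 E] over every measurable
    [E], so it is [1] [P0]-almost everywhere; in particular [dens] does not vanish there. *)
Lemma dens_swap_ae :
  {ae P0, forall x, density P0 P1 x = (dens x)^-1%:E /\ (0 < dens x)%R}.
Proof.
pose q := Radon_Nikodym_SigmaFinite.f P0 P1.
have iq : P1.-integrable setT q by exact: Radon_Nikodym_SigmaFinite.f_integrable P0_ac.
have h : ae_eq P0 setT (cst 1) (fun x => q x * Radon_Nikodym_SigmaFinite.f P1 P0 x).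
  apply: integral_ae_eq => //.
  - exact: integrable_cst_prob.
  - apply: emeasurable_funM; first exact: measurable_int iq.
    exact: measurable_int (Radon_Nikodym_SigmaFinite.f_integrable P1_ac).
  - move=> E _ mE; rewrite Radon_Nikodym_SigmaFinite.change_of_variables//.
    + by rewrite integral_cst// mul1e -(Radon_Nikodym_SigmaFinite.f_integral P0_ac).
    + exact: Radon_Nikodym_SigmaFinite.f_ge0 P0_ac.
    + by apply: measurable_funTS; exact: measurable_int iq.
have h2 := null_dominates_ae P0_ac
  (ae_eq_Radon_Nikodym_SigmaFinite P0_ac measurableT).
apply: filterS2 h h2 => x /(_ I) + /(_ I) => + qE.
rewrite /density -qE /q densE.
have /fineK <- := Radon_Nikodym_SigmaFinite.f_fin_num P0_ac x.
rewrite -EFinM => -[] /= e.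
have r0 : dens x != 0%R by apply/eqP => r0; move: e; rewrite r0 mulr0 => /eqP; rewrite oner_eq0.
split; last by rewrite lt_neqAle eq_sym r0 dens_ge0.
by congr EFin; rewrite -[RHS]mul1r e mulfK.
Qed.

Lemma KL_swap : KL P0 P1 = \int[P0]_x (- L x)%:E.
Proof.
rewrite /KL; case: asboolP => [_|/(_ P0_ac)//].
apply: ae_eq_integral => //.
- apply: (measurableT_comp (@measurable_lne R)).
  have := @Radon_Nikodym_integrable _ _ _ (charge_of_finite_measure P0) P1 P0_ac.
  exact: measurable_int.
- by apply/measurable_EFinP; apply: measurableT_comp => //; exact: measurable_ln_dens.
- apply: filterS dens_swap_ae => x [-> r0] _.
  by rewrite lne_EFin ?invr_gt0// lnV.
Qed.

(** Here [ln y < y] at [y = dens x] bounds [- L] below by the integrable function [- dens]. *)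
Lemma integrable_ln_dens0 : P0.-integrable setT (EFin \o L).
Proof.
have : P0.-integrable setT (EFin \o (fun x => - L x)%R).
  apply: (@integrable_lower_bound _ _ _ _ _ (fun x => - dens x)%R).
  - by apply: measurableT_comp => //; exact: measurable_ln_dens.
  - exact: (integrableN integrable_dens).
  - move=> x; rewrite lerN2 /L; have [->|r0] := eqVneq (dens x) 0%R.
      by rewrite ln0.
    by apply/ltW/ln_sublinear; rewrite lt_neqAle eq_sym r0 dens_ge0.
  - by rewrite -KL_swap.
move=> /integrableN; congr (_.-integrable _ _).
by apply/funext => x /=; rewrite opprK.
Qed.

Lemma KL_swapE : KL P0 P1 = (- \int[P0]_x L x)%R%:E.
Proof.
have iL := integrable_ln_dens0.
rewrite KL_swap /Rintegral EFinN fineK; last exact: (integrable_fin_num measurableT iL).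
rewrite -integralN//=; exact: integrable_add_def iL.
Qed.

Lemma powR_dens_ae b : {ae P0, forall x, (dens x `^ b = expR (b * L x))%R}.
Proof. by apply: filterS dens_swap_ae => x [_ r0]; rewrite /powR gt_eqF. Qed.

Lemma integrable_expR0 b : Bset P0 P1 b ->
  P0.-integrable setT (EFin \o (fun x => expR (b * L x))%R).
Proof.
move=> [b0 Zy]; apply/integrableP; split.
  apply/measurable_EFinP; apply: measurableT_comp => //.
  by apply: measurable_funM => //; exact: measurable_ln_dens.
under eq_integral => x _ do rewrite gee0_abs ?lee_fin ?expR_ge0//.
apply: le_lt_trans Zy; rewrite Zpart_dens le_eqVlt; apply/orP; left; apply/eqP.
apply: ae_eq_integral => //.
- apply/measurable_EFinP; apply: measurableT_comp => //.
  by apply: measurable_funM => //; exact: measurable_ln_dens.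
- by apply/measurable_EFinP; apply: (measurableT_comp (measurable_powR b)); exact: measurable_dens.
- by apply: filterS (powR_dens_ae b) => x ->.
Qed.

(** Both sides are [Zpart b]: [dens] is positive [P0]-almost everywhere, so its power is an
    exponential of [L]. The form under [P0] is the one to which Lyapunov applies. *)
Lemma mgf_swap b : Bset P0 P1 b ->
  (\int[P1]_x expR ((b - 1) * L x) = \int[P0]_x expR (b * L x))%R.
Proof.
move=> Bb; apply: EFin_inj; rewrite -ZpartE// Zpart_dens.
rewrite /Rintegral fineK; last exact: (integrable_fin_num measurableT (integrable_expR0 Bb)).
apply: ae_eq_integral => //.
- by apply/measurable_EFinP; apply: (measurableT_comp (measurable_powR b)); exact: measurable_dens.
- exact: measurable_int (integrable_expR0 Bb).
- by apply: filterS (powR_dens_ae b) => x ->.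
Qed.

Hypothesis ndeg : ~ (exists k : \bar R, {ae P0, forall x, lne (density P1 P0 x) = k}).

Lemma ln_dens_nonconst0 : ~ (exists c, {ae P0, forall x, L x = c}).
Proof.
move=> [c h]; apply: ndeg; exists c%:E.
apply: filterS3 h density_ae dens_swap_ae => x Lx -> [_ r0].
by rewrite lne_EFin// -/(L x) Lx.
Qed.

Lemma ln_dens_nonconst1 : ~ (exists c, {ae P1, forall x, L x = c}).
Proof.
move=> [c h]; apply: ln_dens_nonconst0; exists c.
exact: null_dominates_ae P0_ac h.
Qed.

End reverse.

End change_of_measure.

(** * Monotonicity of [ctilt] through the centered log-density *)

Section centered.
Local Set Implicit Arguments.
Local Unset Strict Implicit.
Context d (T : measurableType d) (R : realType) (P0 P1 : probability T R).
Hypothesis P1_ac : P1 `<< P0.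
Hypothesis KL10_fin : KL P1 P0 < +oo.

Let L x := ln (dens P0 P1 x).
Let K := (\int[P1]_x L x)%R.
Let X x := (L x - K)%R.

Lemma KLE : KL P1 P0 = K%:E.
Proof.
rewrite KL_dens// /K /Rintegral fineK//.
exact: (integrable_fin_num measurableT (integrable_ln_dens P1_ac KL10_fin)).
Qed.

Lemma integrable_centered : P1.-integrable setT (EFin \o X).
Proof.
exact: (integrableB measurableT (integrable_ln_dens P1_ac KL10_fin)
  (integrable_cst_prob P1 K)).
Qed.

Lemma Rintegral_centered : (\int[P1]_x X x = 0)%R.
Proof.
rewrite RintegralB//; first by rewrite Rintegral_cst_prob subrr.
  exact: (integrable_ln_dens P1_ac KL10_fin).
exact: integrable_cst_prob.
Qed.

Lemma integrable_expR_centered b : Bset P0 P1 b ->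
  P1.-integrable setT (EFin \o (fun x => expR ((b - 1) * X x))%R).
Proof.
move=> Bb; have := integrableZl measurableT (expR (- ((b - 1) * K)))
  (integrable_expR1 P1_ac Bb).
congr (_.-integrable _ _); apply/funext => x /=.
by rewrite -EFinM -expRD /X /L; congr (EFin (expR _)); ring.
Qed.

(** Centering takes the factor [expR ((b - 1) * K)] out of the moment, and
    [b * K - (b - 1) * K = K]. *)
Lemma ctilt_centered b : Bset P0 P1 b ->
  ctilt P0 P1 b = (K - ln (\int[P1]_x expR ((b - 1) * X x)))%R%:E.
Proof.
move=> Bb; rewrite (ctiltE P1_ac KL10_fin Bb); apply: (congr1 EFin).
have iX := integrable_expR_centered Bb.
have -> : (\int[P1]_x expR ((b - 1) * ln (dens P0 P1 x)) =
    expR ((b - 1) * K) * \int[P1]_x expR ((b - 1) * X x))%R.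
  rewrite -RintegralZl//; apply: eq_Rintegral => x _.
  by rewrite -expRD /X; congr expR; rewrite /L; ring.
rewrite lnM ?posrE ?expR_gt0//; last exact: Rintegral_expR_gt0.
rewrite expRK -/(Rintegral _ _ _) -/K; ring.
Qed.

Hypothesis nonconst : ~ (exists c, {ae P1, forall x, L x = c}).

(** The exponents [a - 1 < b - 1] are nonnegative, so the centered moment increases. The endpoint
    [a = 1] is included for the maximum. *)
Lemma ctilt_decreasing a b : Bset P0 P1 a -> Bset P0 P1 b ->
  (1 <= a)%R -> (a < b)%R -> ctilt P0 P1 b < ctilt P0 P1 a.
Proof.
move=> Ba Bb a1 ab; rewrite !ctilt_centered// lte_fin ltrD2l ltrN2.
have ia := integrable_expR_centered Ba; have ib := integrable_expR_centered Bb.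
rewrite ltr_ln ?posrE ?Rintegral_expR_gt0//.
apply: mgf_centered_increasing => //.
- exact: integrable_centered.
- exact: Rintegral_centered.
- move=> h; apply: nonconst; exists K; apply: filterS h => x /eqP.
  by rewrite subr_eq0 => /eqP.
- by rewrite subr_ge0.
- by rewrite ltrD2r.
Qed.

Lemma ctilt_increasing a b : Bset P0 P1 a -> Bset P0 P1 b ->
  (a < b)%R -> (b <= 1)%R -> ctilt P0 P1 a < ctilt P0 P1 b.
Proof.
move=> Ba Bb ab b1; rewrite !ctilt_centered// lte_fin ltrD2l ltrN2.
have ia := integrable_expR_centered Ba; have ib := integrable_expR_centered Bb.
rewrite ltr_ln ?posrE ?Rintegral_expR_gt0//.
(* Below [1] the exponents are nonpositive; passing to [- X] gives [0 <= 1 - b < 1 - a], with the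
   order reversed. *)
have flip (c : R) : (fun x => expR ((c - 1) * X x))%R =
    (fun x => expR ((1 - c) * - X x))%R.
  by apply/funext => x; congr expR; ring.
rewrite (flip a) in ia *; rewrite (flip b) in ib *.
apply: (@mgf_centered_increasing _ _ _ P1 (fun x => - X x)%R (1 - b) (1 - a)) => //.
- exact: (integrableN integrable_centered).
- have -> : (\int[P1]_x (- X x) = \int[P1]_x (-1 * X x))%R.
    by apply: eq_Rintegral => x _; rewrite mulN1r.
  by rewrite RintegralZl ?Rintegral_centered ?mulr0//; exact: integrable_centered.
- move=> h; apply: nonconst; exists K; apply: filterS h => x /eqP.
  by rewrite oppr_eq0 subr_eq0 => /eqP.
- by rewrite subr_ge0.
- by rewrite ltrD2l ltrN2.
Qed.

End centered.

(** * The factorisation of [ctilt], and monotonicity and limits in [b] *)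

Theorem lemma5p1 (d : measure_display) (T : measurableType d) (R : realType)
    (P0 P1 : probability T R)
    (P1_ac : P1 `<< P0) (KL10_fin : KL P1 P0 < +oo) :
  (forall b : R, Bset P0 P1 b ->
     ctilt P0 P1 b = b%:E * (KL P1 P0 + lambda P0 P1 b))
  /\
  (KL P0 P1 < +oo ->
   ~ (exists k : \bar R, {ae P0, forall x, lne (density P1 P0 x) = k}) ->
   (* (i) *)
   [/\ forall a b : R, (0 < a)%R -> (a < b)%R -> (b < 1)%R ->
         ctilt P0 P1 a < ctilt P0 P1 b,
       forall a b : R, (1 < a)%R -> (a < b)%R -> b%:E < beta_max P0 P1 ->
         ctilt P0 P1 b < ctilt P0 P1 a,
       ctilt P0 P1 b @[b --> (0 : R)%R^'+] --> (0 : \bar R),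
       forall b : R, Bset P0 P1 b -> ctilt P0 P1 b <= ctilt P0 P1 1%R
     & ctilt P0 P1 1%R = KL P1 P0]
   /\
   (* (ii) *)
   [/\ forall a b : R, Bset P0 P1 a -> Bset P0 P1 b -> (a < b)%R ->
         lambda P0 P1 b < lambda P0 P1 a,
       lambda P0 P1 b @[b --> (0 : R)%R^'+] --> KL P0 P1,
       lambda P0 P1 1%R = 0
     & forall b : R, Bset P0 P1 b -> (1 < b)%R -> lambda P0 P1 b < 0]
   /\
   (* (iii) *)
   (forall a b : R, Bset P0 P1 a -> Bset P0 P1 b -> (a < b)%R ->
      ctilt P0 P1 b / b%:E < ctilt P0 P1 a / a%:E)
   /\
   ctilt P0 P1 b / b%:E @[b --> (0 : R)%R^'+] --> KL P0 P1 + KL P1 P0).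
Proof.
(* Real witnesses for the divergences and [lambda] keep the extended sums and products away from
   infinities. *)
have [k kE] : exists k : R, KL P1 P0 = k%:E by eexists; exact: KLE.
have lamR (b : R) : Bset P0 P1 b -> exists l : R, lambda P0 P1 b = l%:E.
  by move=> Bb; eexists; exact: (lambdaE P1_ac Bb).
have factored (b : R) : Bset P0 P1 b ->
    ctilt P0 P1 b = b%:E * (KL P1 P0 + lambda P0 P1 b).
  move=> Bb; have [b0 _] := Bb.
  rewrite (ctiltE P1_ac KL10_fin Bb) (KLE P1_ac KL10_fin) (lambdaE P1_ac Bb).
  rewrite -EFinD -EFinM; apply: (congr1 EFin).
  by field; rewrite gt_eqF.
split; first exact: factored.
move=> KL01_fin ndeg.
have [j jE] : exists j : R, KL P0 P1 = j%:E by eexists; exact: KL_swapE.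
have nc1 := ln_dens_nonconst1 P1_ac KL01_fin ndeg.
have B1 := Bset1 P1_ac.
have B01 (b : R) : (0 < b)%R -> (b <= 1)%R -> Bset P0 P1 b.
  by move=> b0 b1; exact: (Bset_le P1_ac b0 b1 B1).
have lam_decr (a b : R) : Bset P0 P1 a -> Bset P0 P1 b -> (a < b)%R ->
    lambda P0 P1 b < lambda P0 P1 a.
  move=> Ba Bb ab; have [a0 _] := Ba.
  rewrite (lambdaE P1_ac Ba) (lambdaE P1_ac Bb) lte_fin ltrN2.
  rewrite (mgf_swap P1_ac KL01_fin Ba) (mgf_swap P1_ac KL01_fin Bb).
  apply: (lyapunov_strict a0 ab).
  + exact: (ln_dens_nonconst0 P1_ac KL01_fin ndeg).
  + exact: (integrable_expR0 P1_ac KL01_fin Ba).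
  + exact: (integrable_expR0 P1_ac KL01_fin Bb).
have lam1 : lambda P0 P1 1%R = 0.
  rewrite (lambdaE P1_ac B1) divr1 subrr; apply: (congr1 EFin).
  under eq_Rintegral => x _ do rewrite mul0r expR0.
  by rewrite Rintegral_cst_prob ln1 oppr0.
have c1 : ctilt P0 P1 1%R = KL P1 P0.
  by rewrite (factored _ B1) lam1 adde0 mul1e.
have near01 : \forall b \near (0 : R)^'+, (0 < b <= 1)%R.
  near=> b; apply/andP; split => //.
  by near: b; exact: nbhs_right_le.
have lam_cvg : lambda P0 P1 b @[b --> (0 : R)%R^'+] --> KL P0 P1.
  rewrite (KL_swapE P1_ac KL01_fin).
  have iL := integrable_ln_dens0 P1_ac KL01_fin.
  have i1 : P0.-integrable setT (EFin \o (fun x => expR (ln (dens P0 P1 x)))).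
    have := integrable_expR0 P1_ac KL01_fin B1.
    by congr (_.-integrable _ _); apply/funext => x /=; rewrite mul1r.
  apply: cvg_EFin.
    apply: filterS near01 => b /andP[b0 b1].
    by have [l ->] := lamR _ (B01 _ b0 b1).
  have lam0 : \forall b \near (0 : R)^'+, (- (ln (\int[P0]_x
      expR (b * ln (dens P0 P1 x))) / b))%R = fine (lambda P0 P1 b).
    apply: filterS near01 => b /andP[b0 b1]; have Bb := B01 _ b0 b1.
    by rewrite (lambdaE P1_ac Bb) (mgf_swap P1_ac KL01_fin Bb).
  apply: cvg_trans (near_eq_cvg lam0) _; apply: cvgN.
  exact: ln_mgf_over_cvg iL i1.
have ratio (b : R) : Bset P0 P1 b ->
    ctilt P0 P1 b / b%:E = KL P1 P0 + lambda P0 P1 b.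
  move=> Bb; have [b0 _] := Bb; have [l lE] := lamR _ Bb.
  rewrite (factored _ Bb) kE lE -EFinD -EFinM inver gt_eqF// -EFinM.
  by apply: (congr1 EFin); field; rewrite gt_eqF.
have ratio_cvg : ctilt P0 P1 b / b%:E @[b --> (0 : R)%R^'+] --> KL P0 P1 + KL P1 P0.
  rewrite addeC.
  have sumE : \forall b \near (0 : R)^'+,
      KL P1 P0 + lambda P0 P1 b = ctilt P0 P1 b / b%:E.
    by apply: filterS near01 => b /andP[b0 b1]; rewrite (ratio _ (B01 _ b0 b1)).
  apply: cvg_trans (near_eq_cvg sumE) _; apply: cvgeD lam_cvg.
    by rewrite kE jE.
  exact: cvg_cst.
split; last split; last split.
- split.
  + move=> a b a0 ab b1; apply: (ctilt_increasing P1_ac KL10_fin nc1 _ _ ab (ltW b1)).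
      by apply: B01 => //; rewrite ltW// (lt_trans ab).
    by apply: B01; [exact: lt_trans ab|exact: ltW].
  (* Below the supremum there is some [c] in [Bset] above [b], and [Bset] is closed downwards within
     the positive reals. *)
  + move=> a b a1 ab /ereal_sup_gt[_ [c Bc <-]]; rewrite lte_fin => bc.
    have a0 : (0 < a)%R by exact: lt_trans a1.
    have Bb : Bset P0 P1 b.
      by apply: (Bset_le P1_ac _ (ltW bc) Bc); exact: lt_trans ab.
    apply: (ctilt_decreasing P1_ac KL10_fin nc1 _ Bb (ltW a1) ab).
    exact: (Bset_le P1_ac a0 (ltW ab) Bb).
  + have id_cvg : (b : R)%:E @[b --> (0 : R)%R^'+] --> 0%:E.
      apply: cvg_EFin; first exact: nearW.
      exact: cvg_at_right_filter cvg_id.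
    (* Near [0], [ctilt] is [b] times the ratio, whose limit is finite, so the product tends to
       [0]. *)
    have prodE : \forall b \near (0 : R)^'+,
        b%:E * (ctilt P0 P1 b / b%:E) = ctilt P0 P1 b.
      apply: filterS near01 => b /andP[b0 b1].
      by rewrite (ratio _ (B01 _ b0 b1)) (factored _ (B01 _ b0 b1)).
    apply: cvg_trans (near_eq_cvg prodE) _.
    rewrite -(mul0e (KL P0 P1 + KL P1 P0)); apply: cvgeM => //.
    by rewrite jE kE.
  + move=> b Bb; have [b1|b1|->] := ltgtP b 1%R; last by [].
      exact/ltW/(ctilt_increasing P1_ac KL10_fin nc1 Bb B1).
    exact/ltW/(ctilt_decreasing P1_ac KL10_fin nc1 B1 Bb).
  + exact: c1.
- split; [exact: lam_decr|exact: lam_cvg|exact: lam1|].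
  by move=> b Bb b1; rewrite -lam1; exact: lam_decr.
- move=> a b Ba Bb ab; have lam_ab := lam_decr _ _ Ba Bb ab.
  (* Adding a constant preserves a strict inequality in [\bar R] because [k] is finite. *)
  have ltD2k (u v x y : \bar R) : x = k%:E + u -> y = k%:E + v -> u < v -> x < y.
    by move=> -> ->; rewrite lteD2lE.
  by apply: ltD2k lam_ab; rewrite -kE; exact: ratio.
- exact: ratio_cvg.
Unshelve. all: end_near.
Qed.
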